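(* Let $G$ be a saturated Hausdorff paratopological group and let $G^\flat$ be its group reflexion. If $S$ is a suitable set for $G^\flat$, then $S$ is a suitable set for $G$. If $S$ is a closed suitable set for $G^\flat$, then $S$ is a closed suitable set for $G$.
   Context: A paratopological group is a group $G$ endowed with a topology such that the group operation $G\times G\to G$ is continuous (inversion need not be continuous). The identity is denoted by $e$. A subset $S$ of a paratopological group $G$ is a suitable set for $G$ if $S$ is a discrete subspace of $G$, $S\cup\{e\}$ is closed in $G$, and the subgroup $\langle S\rangle$ of $G$ generated by $S$ is dense in $G$. A closed suitable set is a suitable set that is closed in the group. A paratopological group $G$ is saturated if for each neighborhood $U$ of the identity of $G$, the inverse $U^{-1}$ has non-empty interior in $G$. The group reflexion $G^\flat=(G,\tau^\flat)$ of a paratopological group $(G,\tau)$ is the group $G$ endowed with the strongest topology $\tau^\flat\subset\tau$ turning $G$ into a topological group. *)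

(* Defs.v *)
From HB Require Import structures.
From mathcomp Require Import all_boot all_order all_algebra.
From mathcomp Require Import all_classical topology.

Set Implicit Arguments.
Unset Strict Implicit.
Unset Printing Implicit Defensive.

Local Open Scope classical_set_scope.
Local Open Scope group_scope.

#[short(type="preTopologicalGroupType")]
HB.structure Definition PreTopologicalGroup :=
  {G of Group G & Topological G}.

HB.mixin Record PreTopologicalGroup_isParatopologicalGroup G
    & PreTopologicalGroup G := {
  mulg_continuous : continuous (fun x : G * G => x.1 * x.2)
}.

#[short(type="paratopologicalGroupType")]
HB.structure Definition ParatopologicalGroup :=
  {G of PreTopologicalGroup G & PreTopologicalGroup_isParatopologicalGroup G}.

HB.mixin Record ParatopologicalGroup_isTopologicalGroup G
    & ParatopologicalGroup G := {
  invg_continuous : continuous (fun x : G => x^-1)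
}.

#[short(type="topologicalGroupType")]
HB.structure Definition TopologicalGroup :=
  {G of ParatopologicalGroup G & ParatopologicalGroup_isTopologicalGroup G}.

Definition is_group_topology (G : groupType) (t : Topological G) : Prop :=
  let T : topologicalType := Topological.Pack t in
  continuous (fun x : T * T => ((x.1 : G) * (x.2 : G)) : T) /\
  continuous (fun x : T => (x : G)^-1 : T).

Definition coarser (G : topologicalType) (t : Topological G) : Prop :=
  @open (Topological.Pack t) `<=` @open G.

(* The supremum of all group topologies contained in the topology of G; by
   [open_group_reflexion_sub] and [group_reflexion_max] below it is the
   strongest one. *)
Definition group_reflexion (G : paratopologicalGroupType) : Type :=
  sup_topology
    (fun t : {t : Topological G | is_group_topology t /\ coarser t} => sval t).

Section GroupReflexion.
Variable G : paratopologicalGroupType.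
Local Notation Gf := (group_reflexion G).

HB.instance Definition _ := Group.copy Gf G.
HB.instance Definition _ := Topological.copy Gf
  (sup_topology
    (fun t : {t : Topological G | is_group_topology t /\ coarser t} => sval t)).

Let id_continuous (i : {t : Topological G | is_group_topology t /\ coarser t}) :
  continuous (fun x : Gf => x : Topological.Pack (sval i)).
Proof.
move=> x; have /cvg_sup : nbhs (x : Gf) --> (x : Gf) by exact: cvg_id.
exact.
Qed.

Let mulg_continuous_reflexion : continuous (fun x : Gf * Gf => x.1 * x.2).
Proof.
move=> x; apply/cvg_sup => i; have [[mc _] _] := svalP i.
pose T : topologicalType := Topological.Pack (sval i).
apply: (@continuous_comp (Gf * Gf)%type (T * T)%type T
  (fun y => (y.1 : T, y.2 : T)) (fun y => ((y.1 : G) * (y.2 : G)) : T)).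
  apply: cvg_pair.
    apply: (@cvg_comp _ _ _ fst (fun z : Gf => z : T) (nbhs x) (nbhs x.1)).
      exact: cvg_fst.
    exact: id_continuous.
  apply: (@cvg_comp _ _ _ snd (fun z : Gf => z : T) (nbhs x) (nbhs x.2)).
    exact: cvg_snd.
  exact: id_continuous.
exact: mc.
Qed.

HB.instance Definition _ :=
  PreTopologicalGroup_isParatopologicalGroup.Build Gf mulg_continuous_reflexion.

Let invg_continuous_reflexion : continuous (fun x : Gf => x^-1).
Proof.
move=> x; have xF : Filter (nbhs (x : Gf)) := nbhs_filter x.
apply/cvg_sup => i.
have [[_ vc] _] := svalP i.
pose T : topologicalType := Topological.Pack (sval i).
apply: (@cvg_comp _ _ _ (fun z : Gf => z : T) (fun z : T => (z : G)^-1 : T)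
  (nbhs x) (nbhs (x : T))); first exact: id_continuous.
exact: vc.
Qed.

HB.instance Definition _ :=
  ParatopologicalGroup_isTopologicalGroup.Build Gf invg_continuous_reflexion.

Lemma open_group_reflexion_sub : @open Gf `<=` @open G.
Proof.
have idc : continuous (fun x : G => x : Gf).
  move=> x; apply/cvg_sup => i; have [_ ct] := svalP i.
  suff : continuous (fun y : G => y : Topological.Pack (sval i)) by exact.
  by apply/continuousP => A; exact: ct.
by move/continuousP : idc => idc A /idc.
Qed.

Lemma group_reflexion_max (t : Topological G) :
  is_group_topology t -> coarser t -> @open (Topological.Pack t) `<=` @open Gf.
Proof.
move=> gt ct A oA.
pose i : {t : Topological G | is_group_topology t /\ coarser t} :=
  exist _ t (conj gt ct).
by have /continuousP/(_ A oA) := id_continuous (i := i).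
Qed.

End GroupReflexion.

Definition generated_subgroup (G : groupType) (S : set G) : set G :=
  smallest (fun H : set G => group_closed (mem H)) S.

(* [set_type S] carries the subspace topology. *)
Definition discrete_subspace (T : topologicalType) (S : set T) : Prop :=
  @nbhs (set_type S) _ = @principal_filter (set_type S).

Definition suitable_set (G : paratopologicalGroupType) (S : set G) : Prop :=
  [/\ discrete_subspace S,
      closed (S `|` [set 1]) &
      dense (generated_subgroup S)].

Definition closed_suitable_set (G : paratopologicalGroupType) (S : set G) :
    Prop :=
  suitable_set S /\ closed S.

Definition saturated (G : paratopologicalGroupType) : Prop :=
  forall U : set G, nbhs 1 U -> ([set x^-1 | x in U])° !=set0.

(* Main.v *)
Require Import Defs.
From HB Require Import structures.
From mathcomp Require Import all_boot all_order all_algebra.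
From mathcomp Require Import all_classical topology.

Local Open Scope classical_set_scope.

(** For [U] a neighborhood of [1] in a saturated group [G], the sets [U U^-1]
form a neighborhood base at [1] of a group topology coarser than that of [G],
hence are neighborhoods of [1] in the group reflexion. Saturation gives, for
[V V] contained in [U], a point [v] and a neighborhood [W] of [1] inside [V]
with [W^-1 v] inside [V], so that [W W^-1 v] is contained in [U]. Thus every
nonempty open set of [G] contains a nonempty open set of the reflexion, and
density passes from the reflexion to [G]. *)

Local Open Scope group_scope.

Definition quotients {G : groupType} (U : set G) : set G :=
  [set a / b | a in U & b in U].

Section Paratopological.
Context {G : paratopologicalGroupType}.
Implicit Types (x y : G) (U A : set G).

Lemma mulgl_continuous x : continuous (fun y => x * y).
Proof.
move=> y; apply: (@continuous2_cvg G G G G (nbhs y) _ (fun=> x) id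
  (fun a b => a * b) x y).
- exact: (mulg_continuous (x, y)).
- exact: cvg_cst.
- exact: cvg_id.
Qed.

Lemma mulgr_continuous x : continuous (fun y => y * x).
Proof.
move=> y; apply: (@continuous2_cvg G G G G (nbhs y) _ id (fun=> x)
  (fun a b => a * b) y x).
- exact: (mulg_continuous (y, x)).
- exact: cvg_id.
- exact: cvg_cst.
Qed.

Lemma nbhs1_mull x A : nbhs x A -> nbhs 1 [set y | A (x * y)].
Proof. by move=> xA; apply: mulgl_continuous; rewrite mulg1. Qed.

(** Conjugation is a composite of a left and a right translation, so its continuity does not involve
    that of inversion. *)
Lemma nbhs1_conj x U : nbhs 1 U -> nbhs 1 [set y | U (y ^ x)].
Proof.
move=> nU; apply: (mulgr_continuous x 1 [set z | U (x^-1 * z)]).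
by apply: mulgl_continuous; rewrite mul1g mulVg.
Qed.

Lemma nbhs1_split U : nbhs 1 U ->
  exists2 V, nbhs 1 V & forall a b, V a -> V b -> U (a * b).
Proof.
rewrite -[X in nbhs X U](mulg1 1) => /(mulg_continuous (1 : G, 1 : G)).
case=> -[P Q] [/= nP nQ] PQU; exists (P `&` Q); first exact: filterI.
by move=> a b [Pa _] [_ Qb]; apply: (PQU (a, b)).
Qed.

Hypothesis satG : saturated G.

(** For [y] interior to [U^-1], all [y * w] with [w] near [1] stay in [U^-1]; inverting gives
    [w^-1 * y^-1] in [U], so [v = y^-1]. *)
Lemma saturated_shift U : nbhs 1 U ->
  exists v, nbhs 1 [set w | U (w^-1 * v)].
Proof.
move=> /satG [y /nbhs1_mull yU]; exists y^-1.
apply: filterS yU => w [u Uu uE] /=.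
by rewrite -invgM -uE invgK.
Qed.

Lemma quotients_split U : nbhs 1 U ->
  exists2 W, nbhs 1 W & forall x y,
    quotients W x -> quotients W y -> quotients U (x * y).
Proof.
move=> /nbhs1_split[V nV VU]; have [v nv] := saturated_shift _ nV.
exists (V `&` [set w | V (w^-1 * v)]); first exact: filterI.
move=> _ _ [a [Va _] [b [_ bV] <-]] [c [_ cV] [d [Vd _] <-]].
(* Inserting [v * v^-1] in the middle turns [a b^-1 c d^-1] into [(a b^-1 v) (d c^-1 v)^-1], a
   quotient of two elements of [V V]. *)
exists (a * (b^-1 * v)); first exact: VU.
exists (d * (c^-1 * v)); first exact: VU.
by rewrite !invgM !invgK !mulgA mulgK.
Qed.

Lemma quotients_shift_sub U : nbhs 1 U ->
  exists v W, nbhs 1 W /\ forall x, quotients W x -> U (x * v).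
Proof.
move=> /nbhs1_split[V nV VU]; have [v nv] := saturated_shift _ nV.
exists v, (V `&` [set w | V (w^-1 * v)]); split; first exact: filterI.
by move=> _ [a [Va _] [b [_ bV] <-]]; rewrite -mulgA; exact: VU.
Qed.

End Paratopological.

Lemma quotients1 {G : groupType} (U : set G) : U 1 -> quotients U 1.
Proof. by move=> U1; exists 1 => //; exists 1; rewrite ?divg1. Qed.

Lemma quotientsV {G : groupType} (U : set G) x :
  quotients U x -> quotients U x^-1.
Proof. by case=> a Ua [b Ub <-]; exists b => //; exists a; rewrite ?invgF. Qed.

Lemma sub_quotients {G : groupType} (U V : set G) :
  U `<=` V -> quotients U `<=` quotients V.
Proof.
move=> UV _ [a Ua [b Ub <-]].
by exists a; [exact: UV|exists b => //; exact: UV].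
Qed.

Lemma quotients_conj {G : groupType} (U : set G) x y :
  quotients [set z | U (z ^ x)] y -> quotients U (y ^ x).
Proof.
by case=> a Ua [b Ub <-]; exists (a ^ x) => //; exists (b ^ x);
   rewrite // conjMg conjVg.
Qed.

(** A synonym of [G] that can carry a second topology. The proof [satG] is a parameter because the
    neighborhood axioms rely on [quotients_split]. *)
Definition quotient_topology (G : paratopologicalGroupType)
  (satG : saturated G) : Type := G.

Section QuotientTopology.
Context {G : paratopologicalGroupType} (satG : saturated G).
Local Notation Q := (quotient_topology G satG).

Definition quotient_nbhs (x : Q) : set_system Q :=
  [set A | exists2 U : set G,
     nbhs 1 U & forall z, quotients U z -> A ((x : G) * z)].

HB.instance Definition _ := Choice.copy Q G.
HB.instance Definition _ := hasNbhs.Build Q quotient_nbhs.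

Let quotient_nbhs_filter (x : Q) : ProperFilter (nbhs x).
Proof.
apply: Build_ProperFilter_ex.
  move=> A [U nU UA]; exists x; rewrite -[x](mulg1 (x : G)); apply: UA.
  by apply: quotients1; exact: nbhs_singleton.
split.
- by exists setT; [exact: filterT|].
- move=> A B [U nU UA] [V nV VB]; exists (U `&` V); first exact: filterI.
  by move=> z UVz; split; [apply: UA|apply: VB];
     apply: sub_quotients UVz => ? [].
- by move=> A B AB [U nU UA]; exists U => // z /UA /AB.
Qed.

Let quotient_nbhs_singleton (x : Q) (A : set Q) : nbhs x A -> A x.
Proof.
case=> U nU UA; rewrite -[x](mulg1 (x : G)); apply: UA.
by apply: quotients1; exact: nbhs_singleton.
Qed.

Let quotient_nbhs_nbhs (x : Q) (A : set Q) : nbhs x A -> nbhs x (nbhs^~ A).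
Proof.
(* The same [W] serves at every point of [x W W^-1], as [W W^-1 W W^-1] lies in [U U^-1]. *)
case=> U /(quotients_split satG)[W nW WU] UA; exists W => // y Wy.
by exists W => // z Wz; rewrite -mulgA; exact/UA/WU.
Qed.

HB.instance Definition _ := Nbhs_isNbhsTopological.Build Q
  quotient_nbhs_filter quotient_nbhs_singleton quotient_nbhs_nbhs.

Definition quotient_topology_class : Topological G := Topological.class Q.

(** Basic neighborhoods are left translates, so the small factor must be moved to the right of [y],
    or of [x^-1]; this conjugates it, and the neighborhood is conjugated in advance to
    compensate. *)
Lemma quotient_topology_group : is_group_topology quotient_topology_class.
Proof.
split.
  move=> [x y] A [U /(quotients_split satG)[W nW WU] UA].
  exists ([set z | exists2 p, quotients [set a | W (a ^ y)] p & z = x * p],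
          [set z | exists2 q, quotients W q & z = y * q]).
    split.
      by exists [set a | W (a ^ y)]; [exact: nbhs1_conj|move=> p; exists p].
    by exists W => // q; exists q.
  move=> [_ _] [/= [p Wp ->] [q Wq ->]].
  have -> : x * p * (y * q) = x * y * (p ^ y * q).
    by rewrite conjgE !mulgA mulgK.
  by apply/UA/WU => //; exact: quotients_conj.
move=> x A [U nU UA].
exists [set a | U (a ^ x^-1)]; first exact: nbhs1_conj.
move=> z Uz /=.
have -> : (x * z)^-1 = x^-1 * (z ^ x^-1)^-1.
  by rewrite conjgE !invgM !invgK !mulgA mulVg mul1g.
exact/UA/quotientsV/quotients_conj.
Qed.

(** As [1] is in [U], the set [U U^-1] contains [U]. *)
Lemma quotient_topology_coarser : coarser quotient_topology_class.
Proof.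
move=> A; rewrite !openE => oA x /oA [U nU UA].
have : nbhs x [set y | U (x^-1 * y)].
  by apply: mulgl_continuous; rewrite mulVg.
apply: filterS => y Uy; rewrite -[y](mulVKg x); apply: UA.
exists (x^-1 * y) => //; exists 1; last by rewrite divg1.
exact: nbhs_singleton.
Qed.

Lemma nbhs_quotients_group_reflexion (x : G) (U : set G) : nbhs 1 U ->
  nbhs (x : group_reflexion G) [set x * z | z in quotients U].
Proof.
move=> nU.
have : nbhs (x : Q) [set x * z | z in quotients U].
  by exists U => // z Uz; exists z.
rewrite nbhsE => -[B [oB Bx] BU]; rewrite nbhsE; exists B => //; split => //.
exact: group_reflexion_max quotient_topology_group
  quotient_topology_coarser _ oB.
Qed.

Lemma dense_group_reflexion (D : set G) :
  @dense (group_reflexion G) D -> dense D.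
Proof.
move=> dD A [x Ax] oA.
have /nbhs1_mull xA : nbhs x A by exact: open_nbhs_nbhs.
have [v [W [nW WA]]] := quotients_shift_sub satG _ xA.
(* [x W W^-1 v] is rewritten as [x v K K^-1], where [K] is the conjugate of
   [W] by [v], to become a left translate. *)
have nK : nbhs 1 [set k | W (k ^ v^-1)] by exact: nbhs1_conj.
have := nbhs_quotients_group_reflexion (x * v) _ nK.
rewrite nbhsE => -[B [oB Bxv] BK].
have [y [By Dy]] := dD B (ex_intro _ _ Bxv) oB.
exists y; split => //; have [z /quotients_conj Kz <-] := BK _ By.
(* Since [z ^ v^-1 = v z v^-1] is in [W W^-1], the product [(z ^ v^-1) v = v z] lies in [x^-1 A]. *)
by have /= := WA _ Kz; rewrite conjgE invgK !mulgA mulgVK.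
Qed.

End QuotientTopology.

Lemma closed_group_reflexion (G : paratopologicalGroupType) (A : set G) :
  @closed (group_reflexion G) A -> closed A.
Proof.
move=> /(@closed_openC (group_reflexion G)) /open_group_reflexion_sub.
by move/open_closedC; rewrite setCK.
Qed.

(** Phrased with open sets of the ambient space, discreteness visibly survives refinement of the
    topology. *)
Lemma discrete_subspaceP (T : topologicalType) (A : set T) :
  discrete_subspace A <->
  forall x, A x -> exists2 C, open_nbhs x C & C `&` A `<=` [set x].
Proof.
split=> [dA x Ax|dA].
  pose a : A := exist _ x (mem_set Ax).
  have : nbhs a [set a] by rewrite dA; exact/principal_filterP.
  case=> _ [[C oC <-] Ca CA]; exists C; first by split.
  move=> y [Cy Ay]; have := CA (exist _ y (mem_set Ay)) Cy.
  by move/(congr1 set_val).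
apply/funext => x; apply/seteqP; split => B.
  by move=> /nbhs_singleton Bx; apply/principal_filterP.
move=> /principal_filterP Bx.
have [C [oC Cx] CA] := dA _ (set_valP x).
exists (set_val @^-1` C); split => //; first by exists C.
move=> y Cy; suff -> : y = x by [].
by apply/val_inj/(CA (set_val y)); split=> //; exact: set_valP.
Qed.

Lemma discrete_group_reflexion (G : paratopologicalGroupType) (A : set G) :
  @discrete_subspace (group_reflexion G) A -> discrete_subspace A.
Proof.
move=> /discrete_subspaceP dA; apply/discrete_subspaceP => x /dA[C [oC Cx] CA].
by exists C => //; split => //; exact: open_group_reflexion_sub.
Qed.

Theorem proposition4p2 (G : paratopologicalGroupType)
    (satG : saturated G) (hausG : hausdorff_space G) (S : set G) :
  (@suitable_set (group_reflexion G) S -> @suitable_set G S) /\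
  (@closed_suitable_set (group_reflexion G) S -> @closed_suitable_set G S).
Proof.
have suitS : @suitable_set (group_reflexion G) S -> @suitable_set G S.
  case=> dS cS gS; split; first exact: discrete_group_reflexion.
    exact: closed_group_reflexion.
  exact: dense_group_reflexion.
split=> // -[/suitS sS cS]; split=> //; exact: closed_group_reflexion.
Qed.
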